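(* Let $\mathcal{T}$ be a nonempty $E$-closed family of complete first-order theories in a language $\Sigma$. Then every locally $\mathcal{T}$-consistent $d$-definable set $\mathcal{T}_\Phi$ is $\mathcal{T}$-consistent. That is, for every set $\Phi$ of $\Sigma$-sentences, if $\mathcal{T}_{\Phi_0}\neq\emptyset$ for every finite $\Phi_0\subseteq\Phi$, then $\mathcal{T}_\Phi\neq\emptyset$.
   Context: All languages are predicate (relational) languages. A family of theories is a set $\mathcal{T}$ of complete first-order theories in one language $\Sigma$; each theory is identified with the deductively closed set of $\Sigma$-sentences it contains. For a $\Sigma$-sentence $\varphi$, $\mathcal{T}_\varphi=\{T\in\mathcal{T}\mid\varphi\in T\}$; for a set $\Phi$ of $\Sigma$-sentences, $\mathcal{T}_\Phi=\bigcap_{\varphi\in\Phi}\mathcal{T}_\varphi=\{T\in\mathcal{T}\mid\Phi\subseteq T\}$ (with $\mathcal{T}_\emptyset=\mathcal{T}$); such sets are called $d$-definable. $\mathcal{T}_\Phi$ is $\mathcal{T}$-consistent if $\mathcal{T}_\Phi\neq\emptyset$, and locally $\mathcal{T}$-consistent if $\mathcal{T}_{\Phi_0}\ne\emptyset$ for each finite $\Phi_0\subseteq\Phi$. $E$-closure: ${\rm Cl}_E(\mathcal{T})$ is the set of theories of $E$-classes (as $\Sigma$-structures) in structures elementarily equivalent to the $E$-combination of models of the theories in $\mathcal{T}$ (the disjoint union of such models, with a new equivalence relation $E$ whose classes are these models). By a known result, equivalently: a complete $\Sigma$-theory $T$ is in ${\rm Cl}_E(\mathcal{T})$ if and only if $T\in\mathcal{T}$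 or $\mathcal{T}_\varphi$ is infinite for every $\varphi\in T$. $\mathcal{T}$ is $E$-closed if $\mathcal{T}={\rm Cl}_E(\mathcal{T})$. *)

(* Defs.v *)
From mathcomp Require Import all_boot.
From mathcomp Require Import boolp classical_sets cardinality.

Set Implicit Arguments.
Unset Strict Implicit.
Unset Printing Implicit Defensive.

Local Open Scope classical_set_scope.

Record language := Language { symb : Type; arity : symb -> nat }.

(* [formula L n]: first-order formulas with equality whose free variables are
   the de Bruijn indices 0, ..., n-1; [Fall] binds index 0 of its body. *)
Inductive formula (L : language) : nat -> Type :=
| Fbot n : formula L n
| Feq n (x y : 'I_n) : formula L n
| Frel n (R : symb L) (args : (arity R).-tuple 'I_n) : formula L n
| Fimp n (f g : formula L n) : formula L n
| Fall n (f : formula L n.+1) : formula L n.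

Definition sentence (L : language) := formula L 0.

Definition Fneg (L : language) (n : nat) (f : formula L n) : formula L n :=
  Fimp f (Fbot L n).

Record structure (L : language) := Structure {
  carrier :> Type;
  carrier_inhabited : inhabited carrier;
  interp : forall R : symb L, (arity R).-tuple carrier -> Prop
}.

Definition vcons (U : Type) (n : nat) (u : U) (v : 'I_n -> U) (k : 'I_n.+1) : U :=
  if unlift ord0 k is Some j then v j else u.

Fixpoint holds (L : language) (M : structure L) (n : nat) (f : formula L n) :
    ('I_n -> M) -> Prop :=
  match f in formula _ n return ('I_n -> M) -> Prop with
  | Fbot _ => fun _ => False
  | Feq _ x y => fun v => v x = v y
  | Frel _ R args => fun v => @interp L M R (map_tuple v args)
  | Fimp _ f g => fun v => holds f v -> holds g v
  | Fall _ f => fun v => forall u : M, holds f (vcons u v)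
  end.

Definition no_vars (U : Type) (k : 'I_0) : U :=
  False_rect U (notF (ltn_ord k)).

Definition satisfies (L : language) (M : structure L) (f : sentence L) : Prop :=
  holds f (@no_vars M).

Definition theory (L : language) := set (sentence L).

Definition models (L : language) (M : structure L) (Phi : set (sentence L)) : Prop :=
  forall f, Phi f -> satisfies M f.

Definition entails (L : language) (Phi : set (sentence L)) (f : sentence L) : Prop :=
  forall M : structure L, models M Phi -> satisfies M f.

(* Consistency and deductive closure are taken with respect to semantic
   consequence. *)
Definition complete_theory (L : language) (T : theory L) : Prop :=
  [/\ exists M : structure L, models M T,
      forall f, entails T f -> T f
    & forall f, T f \/ T (Fneg f)].

Definition theory_of (L : language) (M : structure L) : theory L :=
  [set f | satisfies M f].

Definition elem_equiv (L : language) (M N : structure L) : Prop :=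
  theory_of M = theory_of N.

(* The language of E-combinations: [None] is the new symbol E.  Symbols of
   positive arity keep their arity.  A 0-ary symbol becomes unary, so that every
   E-class retains its own truth value for it; it is read as "the class of x
   satisfies R". *)
Definition arityE (L : language) (R : option (symb L)) : nat :=
  if R is Some R' then (arity R').-1.+1 else 2.

Definition languageE (L : language) : language := Language (@arityE L).

Section Combination.
Context (L : language) (I : Type) (I_inh : inhabited I) (A : I -> structure L).

Definition comb_carrier : Type := {i : I & carrier (A i)}.

Lemma comb_carrier_inhabited : inhabited comb_carrier.
Proof.
by have [i] := I_inh; have [x] := carrier_inhabited (A i); split; exists i.
Qed.

(* The n first entries of a tuple of length max(n, 1): all of them unless
   n = 0. *)
Definition trunc (U : Type) (n : nat) (b : n.-1.+1.-tuple U) : n.-tuple U :=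
  [tuple tnth b (widen_ord (leqSpred n) k) | k < n].

Definition comb_interp (R : option (symb L)) :
    (arityE R).-tuple comb_carrier -> Prop :=
  match R with
  | Some R => fun t =>
      exists i (b : (arity R).-1.+1.-tuple (A i)),
        t = map_tuple (Tagged (fun j => carrier (A j))) b
        /\ interp (trunc b)
  | None => fun t => tag (tnth t ord0) = tag (tnth t ord_max)
  end.

(* The disjoint union of the A i, with E the relation "being in the same A i". *)
Definition E_combination : structure (languageE L) :=
  @Structure (languageE L) comb_carrier comb_carrier_inhabited comb_interp.

End Combination.

Section EClass.
Context (L : language) (N : structure (languageE L)) (a : N).

Definition class_carrier : Type :=
  {x : N | @interp (languageE L) N None [tuple a; x]}.

(* The tuple b itself, unless n = 0, where it is the 1-tuple a. *)
Definition pad (n : nat) (b : n.-tuple class_carrier) : n.-1.+1.-tuple N :=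
  [tuple if insub (val k) is Some j then sval (tnth b j) else a | k < n.-1.+1].

Definition class_interp (R : symb L) (b : (arity R).-tuple class_carrier) : Prop :=
  @interp (languageE L) N (Some R) (pad b).

(* The E-class of a as an L-structure. *)
Definition E_class (class_inh : inhabited class_carrier) : structure L :=
  @Structure L class_carrier class_inh class_interp.

End EClass.

Definition ClE (L : language) (F : set (theory L)) : set (theory L) :=
  [set T |
    exists (F_inh : inhabited {S : theory L | F S})
           (A : {S : theory L | F S} -> structure L)
           (N : structure (languageE L)) (a : N)
           (class_inh : inhabited (class_carrier a)),
      [/\ forall S, models (A S) (sval S),
          elem_equiv N (E_combination F_inh A)
        & T = theory_of (E_class class_inh)]].

Definition E_closed (L : language) (F : set (theory L)) : Prop := F = ClE F.

Definition d_definable (L : language) (F : set (theory L))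
    (Phi : set (sentence L)) : set (theory L) :=
  [set T | F T /\ Phi `<=` T].

Definition consistent (L : language) (F : set (theory L))
    (Phi : set (sentence L)) : Prop :=
  d_definable F Phi !=set0.

Definition locally_consistent (L : language) (F : set (theory L))
    (Phi : set (sentence L)) : Prop :=
  forall Phi0 : set (sentence L),
    finite_set Phi0 -> Phi0 `<=` Phi -> consistent F Phi0.

(* Main.v *)
Require Import Defs.
From mathcomp Require Import all_boot.
From mathcomp Require Import boolp classical_sets cardinality filter.

Set Implicit Arguments.
Unset Strict Implicit.
Unset Printing Implicit Defensive.

Local Open Scope classical_set_scope.

(** The witness is built by ultraproducts, with the family F itself as index
    set.  Local consistency of Phi says that the sets of theories in F that
    contain a given finite part of Phi generate a proper filter on F; extend it
    to an ultrafilter U, so that every sentence of Phi belongs to U-almost every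
    theory of F ([ultrafilter_of_locally_consistent]).

    Choose a model A_S of each theory S in F, let C be the E-combination of these
    models and N the ultrapower of C along U.  By the theorem of Łoś N is
    elementarily equivalent to C.  Pick a point x_S in each A_S and look at the
    E-class in N of the element represented by the family of all x_S.  A family
    (c_S) of points of C represents a member of that class exactly when c_S lies
    in A_S for U-almost all S; since relations of N are computed U-almost
    everywhere as well, the class is the ultraproduct of the A_S along U
    ([diagonal_class_ultraproduct]).  Applying the theorem of Łoś again, now in
    the smaller language, the class satisfies every sentence that is true in
    U-almost all A_S, in particular every sentence of Phi.  Its theory lies in the
    E-closure of F by definition, hence in F.

    The theorem of Łoś is used for two structures of different origin, a
    quotient of a product and an E-class.  It is therefore proved for any
    structure that has the defining property of an ultraproduct
    ([is_ultraproduct]), so that no isomorphism has to be transported. *)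

Lemma inhabited_forall (I : Type) (M : I -> Type) :
  (forall i, inhabited (M i)) -> inhabited (forall i, M i).
Proof.
move=> M_inh.
have point i : exists u : M i, True by have [u] := M_inh i; exists u.
by split=> i; exact: (sval (cid (point i))).
Qed.

(** * Ultraproducts *)

(** [p] plays the part of the quotient map from the product.  Surjectivity and
    the behaviour of equality and relations under [p] are all that the theorem of
    Łoś uses, and they determine [P] up to isomorphism. *)
Record is_ultraproduct (L : language) (I : Type) (U : set_system I)
    (M : I -> structure L) (P : structure L) (p : (forall i, M i) -> P) :
    Prop := IsUltraproduct {
  ultraproduct_surj : forall y : P, exists f, p f = y;
  ultraproduct_eq : forall f g, p f = p g <-> U [set i | f i = g i];
  ultraproduct_interp :
    forall (R : symb L) (t : (arity R).-tuple (forall i, M i)),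
      @interp L P R (map_tuple p t) <->
      U [set i | @interp L (M i) R (map_tuple (fun f => f i) t)]
}.

Lemma iff_in_system (I : Type) (U : set_system I) (A B : set I) :
  (forall i, A i <-> B i) -> U A <-> U B.
Proof. by move=> AB; suff -> : A = B by []; apply/seteqP; split=> i /AB. Qed.

(** Maximality of U is essential for the left-to-right direction: if A is not
    large then its complement is, and the implication holds on it vacuously. *)
Lemma ultra_imply (I : Type) (U : set_system I) (A B : set I) :
  UltraFilter U ->
  (U A -> U B) <-> U [set i | A i -> B i].
Proof.
move=> UU; split=> [UAB|UAB UA]; last by apply: filterS2 UAB UA => i; apply.
have [/UAB UB|UnA] := in_ultra_setVsetC A UU.
  by apply: filterS UB => i Bi _.
by apply: filterS UnA => i nAi /nAi.
Qed.

(** By choice, some f picks at each index a counterexample to B whenever there is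
    one; B can hold of f only at indices where it holds everywhere. *)
Lemma filter_forall_section (I : Type) (U : set_system I) (M : I -> Type)
    (B : forall i, M i -> Prop) :
  Filter U -> (forall i, inhabited (M i)) ->
  (forall f : forall i, M i, U [set i | B i (f i)]) <->
  U [set i | forall u, B i u].
Proof.
move=> UF M_inh; split=> [UB|UB f]; last first.
  by apply: filterS UB => i Bi; apply: Bi.
have witness i : exists u, B i u -> forall u, B i u.
  have [Bi|/existsNP[u nBu]] := pselect (forall u, B i u).
    by have [u] := M_inh i; exists u.
  by exists u.
pose f i := sval (cid (witness i)).
by apply: filterS (UB f) => i; apply: (svalP (cid (witness i))).
Qed.

Lemma comp_vcons (T V : Type) (h : T -> V) n (u : T) (v : 'I_n -> T) :
  (fun k => h (vcons u v k)) = vcons (h u) (fun k => h (v k)).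
Proof. by apply: funext => k; rewrite /vcons; case: unlift. Qed.

(** Łoś's theorem.  Atomic formulas are settled by the definition of an
    ultraproduct; implication is where U has to be an ultrafilter, and the
    quantifier is where the axiom of choice and surjectivity of [p] enter. *)
Theorem Los (L : language) (I : Type) (U : set_system I)
    (M : I -> structure L) (P : structure L) (p : (forall i, M i) -> P) :
  UltraFilter U -> is_ultraproduct U p ->
  forall n (f : formula L n) (v : 'I_n -> forall i, M i),
    holds f (fun k => p (v k)) <->
    U [set i | holds f (fun k => v k i)].
Proof.
move=> UU UP n; elim=> {n} [n|n x y|n R args|n f IHf g IHg|n f IHf] v /=.
- split=> // Ufalse; exact: (filter_not_empty U).
- exact: (ultraproduct_eq UP).
- have -> : map_tuple (fun k => p (v k)) args = map_tuple p (map_tuple v args).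
    by apply: val_inj; rewrite /= -map_comp.
  rewrite (ultraproduct_interp UP); apply: iff_in_system => i /=.
  suff -> : map_tuple (fun g : forall j, M j => g i) (map_tuple v args) =
            map_tuple (fun k => v k i) args by [].
  by apply: val_inj; rewrite /= -map_comp.
- by rewrite IHf IHg; apply: ultra_imply.
- rewrite -(filter_forall_section (fun i u => holds f (vcons u (fun k => v k i)))) //;
    last by move=> i; apply: carrier_inhabited.
  have IH u : holds f (vcons (p u) (fun k => p (v k))) <->
      U [set i | holds f (vcons (u i) (fun k => v k i))].
    rewrite -comp_vcons IHf; apply: iff_in_system => i /=.
    by rewrite (comp_vcons (fun g : forall i, M i => g i)).
  split=> [hf u|hf y]; first exact/IH.
  by have [u <-] := ultraproduct_surj UP y; apply/IH.
Qed.

Corollary Los_sentence (L : language) (I : Type) (U : set_system I)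
    (M : I -> structure L) (P : structure L) (p : (forall i, M i) -> P) :
  UltraFilter U -> is_ultraproduct U p ->
  forall f : sentence L,
    satisfies P f <-> U [set i | satisfies (M i) f].
Proof.
move=> UU UP f.
have no_varsE T (v : 'I_0 -> T) : v = @no_vars T by apply: funext => -[].
rewrite /satisfies -(no_varsE _ (fun k => p (no_vars (forall i, M i) k))).
rewrite (Los UU UP).
apply: iff_in_system => i /=.
by rewrite -(no_varsE (M i) (fun k => no_vars (forall i, M i) k i)).
Qed.

Section Ultraproduct.
Context (L : language) (I : Type) (U : set_system I) (M : I -> structure L).
Context (U_filter : Filter U).

Definition germ (f : forall i, M i) : set (forall i, M i) :=
  [set g | U [set i | f i = g i]].

(** Elements are the equivalence classes themselves, as sets, so that equality in
    the ultraproduct is equality of Rocq, as the semantics of [Feq] demands. *)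
Definition ultraproduct_carrier : Type := {X | exists f, X = germ f}.

Definition to_ultraproduct (f : forall i, M i) : ultraproduct_carrier :=
  exist _ (germ f) (ex_intro _ f erefl).

Lemma ultraproduct_inhabited : inhabited ultraproduct_carrier.
Proof.
have [f] := inhabited_forall (fun i => carrier_inhabited (M i)).
by split; exact: to_ultraproduct f.
Qed.

Definition ultraproduct : structure L :=
  @Structure L ultraproduct_carrier ultraproduct_inhabited
    (fun R t => exists2 s : (arity R).-tuple (forall i, M i),
       t = map_tuple to_ultraproduct s &
       U [set i | @interp L (M i) R (map_tuple (fun f => f i) s)]).

Lemma to_ultraproduct_eq f g :
  to_ultraproduct f = to_ultraproduct g <-> U [set i | f i = g i].
Proof.
split=> [/(congr1 sval)/= fg|fg].
  suff : germ f g by [].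
  by rewrite fg; apply: nearW.
apply: eq_exist; apply: eq_set => h; apply: propext; split=> H.
  by apply: filterS2 fg H => i /= ->.
by apply: filterS2 fg H => i /= ->.
Qed.

Lemma ultraproductP : is_ultraproduct U (P := ultraproduct) to_ultraproduct.
Proof.
split=> [[X [f Xf]]|f g|R t].
- by exists f; apply: eq_exist.
- exact: to_ultraproduct_eq.
- split=> [[s ts Us]|Ut]; last by exists t.
  have near_st : U [set i | forall k, tnth t k i = tnth s k i].
    apply: filter_forall => k; apply/to_ultraproduct_eq.
    by have := congr1 (fun w => tnth w k) ts; rewrite !tnth_map.
  apply: filterS2 near_st Us => i /= st.
  suff -> : map_tuple (fun f : forall j, M j => f i) t =
            map_tuple (fun f : forall j, M j => f i) s by [].
  by apply: eq_from_tnth => k; rewrite !tnth_map.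
Qed.

End Ultraproduct.

Corollary ultraproduct_exists (L : language) (I : Type) (U : set_system I)
    (M : I -> structure L) :
  Filter U -> exists (P : structure L) p, is_ultraproduct U (M := M) (P := P) p.
Proof. by move=> UF; do 2![eexists]; exact: ultraproductP. Qed.

(** * Classes of an ultrapower of an E-combination *)

(** The common form of [pad] and of a right inverse of [trunc]: for n > 0 it
    returns t, for n = 0 the 1-tuple x. *)
Definition padding (T : Type) n (x : T) (t : n.-tuple T) : n.-1.+1.-tuple T :=
  [tuple if insub (val k) is Some j then tnth t j else x | k < n.-1.+1].

Lemma map_padding (T V : Type) (h : T -> V) n (x : T) (t : n.-tuple T) :
  map_tuple h (padding x t) = padding (h x) (map_tuple h t).
Proof.
apply: eq_from_tnth => k; rewrite tnth_map !tnth_mktuple.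
by case: insub => [j|//]; rewrite tnth_map.
Qed.

Lemma pad_padding (L : language) (N : structure (languageE L)) (a : N) n
    (b : n.-tuple (class_carrier a)) :
  pad b = padding a (map_tuple sval b).
Proof.
apply: eq_from_tnth => k; rewrite !tnth_mktuple.
by case: insub => [j|//]; rewrite tnth_map.
Qed.

Lemma trunc_padding (T : Type) n (x : T) (t : n.-tuple T) :
  trunc (padding x t) = t.
Proof.
apply: eq_from_tnth => k; rewrite !tnth_mktuple.
by rewrite (insubT (fun m => m < n) (ltn_ord k)); congr tnth; apply: val_inj.
Qed.

Lemma Tagged_inj (I : Type) (A : I -> Type) i :
  injective (Tagged A : A i -> {i & A i}).
Proof.
move=> x y xy; have := projT2_eq xy.
by rewrite (Prop_irrelevance (projT1_eq xy) erefl).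
Qed.

Section CombinationUltrapower.
Context (L : language) (I : Type) (I_inh : inhabited I) (A : I -> structure L).
Local Notation C := (E_combination I_inh A).
Local Notation inC := (Tagged (fun j => carrier (A j))).

(** Each component sits inside the E-combination with its own relations, 0-ary
    ones included.  That arities in the combination are positive is what
    recovers the component from a tuple. *)
Lemma E_combination_interp (R : symb L) i (x : A i) (t : (arity R).-tuple (A i)) :
  @interp (languageE L) C (Some R) (padding (inC x) (map_tuple inC t)) <->
  @interp L (A i) R t.
Proof.
rewrite -map_padding; split=> [[j [b [tb]]]|Rt]; last first.
  by exists i, (padding x t); split; [|rewrite trunc_padding].
(* The tuples are nonempty, so their heads reveal the component. *)
have ij : i = j.
  by have := congr1 (fun s => tag (tnth s ord0)) tb; rewrite !tnth_map.
subst j; suff -> : b = padding x t by rewrite trunc_padding.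
apply: eq_from_tnth => k; apply: (@Tagged_inj _ (fun j => carrier (A j))).
by have := congr1 (fun s => tnth s k) tb; rewrite !tnth_map.
Qed.

Context (U : set_system I) (U_ultra : UltraFilter U).
Context (N : structure (languageE L)) (p : (I -> C) -> N).
Context (UN : is_ultraproduct U (M := fun=> C) p).

Lemma ultrapower_E f g :
  @interp (languageE L) N None [tuple p f; p g] <->
  U [set i | tag (f i) = tag (g i)].
Proof.
have -> : [tuple p f; p g] = map_tuple p [tuple f; g] by apply: val_inj.
exact: (@ultraproduct_interp _ _ _ _ _ _ UN None).
Qed.

Lemma ultrapower_elem_equiv : elem_equiv N C.
Proof.
apply: eq_set => f; apply: propext; rewrite (Los_sentence U_ultra UN).
by split=> [/filter_ex[]|Cf] //; apply: nearW.
Qed.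

Context (x : forall i, A i).

Let a : N := p (fun i => inC (x i)).

Let diagonal_proof (f : forall i, A i) :
  @interp (languageE L) N None [tuple a; p (fun i => inC (f i))].
Proof. by apply/ultrapower_E; apply: nearW. Qed.

(** A family with one point in each component is a family of points of C that is
    everywhere E-related to x, so it represents an element of the class of a. *)
Definition diagonal (f : forall i, A i) : class_carrier a :=
  exist _ (p (fun i => inC (f i))) (diagonal_proof f).

(** An element of the class of a is represented by a family (h i) of points of C
    with h i in component i for U-almost all i; changing h on the remaining
    indices alters nothing, hence surjectivity.  For relations, the values that
    the ultrapower takes U-almost everywhere are those of the components, by
    [E_combination_interp]. *)
Lemma diagonal_class_ultraproduct :
  is_ultraproduct U (P := E_class (inhabits (diagonal x))) diagonal.
Proof.
split=> [[y Ey]|f g|R t].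
- have [h hy] := ultraproduct_surj UN y; subst y.
  have lift i : exists u : A i, i = tag (h i) -> inC u = h i.
    have [ih|nih] := pselect (i = tag (h i)); last by exists (x i).
    by case: (h i) ih => j u /= ij; subst j; exists u.
  exists (fun i => sval (cid (lift i))); apply: eq_exist.
  apply/(ultraproduct_eq UN); move: Ey; rewrite ultrapower_E.
  by apply: filterS => i; exact: (svalP (cid (lift i))).
- have -> : diagonal f = diagonal g <->
      p (fun i => inC (f i)) = p (fun i => inC (g i)).
    by split=> [/(congr1 sval)|fg] //; apply: eq_exist.
  rewrite (ultraproduct_eq UN).
  by split; apply: filterS => i; [exact: Tagged_inj | move=> /= ->].
- rewrite /= /class_interp pad_padding.
  have -> : padding a (map_tuple sval (map_tuple diagonal t)) =
      map_tuple p (padding (fun i => inC (x i))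
                     (map_tuple (fun f i => inC (f i)) t)).
    by rewrite map_padding; congr padding; apply: val_inj; rewrite /= -!map_comp.
  rewrite (@ultraproduct_interp _ _ _ _ _ _ UN (Some R)).
  have pointwise i : @interp (languageE L) C (Some R)
      (map_tuple (@^~ i) (padding (fun i => inC (x i))
                            (map_tuple (fun f i => inC (f i)) t))) <->
      @interp L (A i) R (map_tuple (@^~ i) t).
    rewrite -(E_combination_interp (x i)) map_padding.
    have -> // : map_tuple (@^~ i) (map_tuple (fun f i => inC (f i)) t) =
                 map_tuple inC (map_tuple (@^~ i) t).
    by apply: val_inj; rewrite /= -!map_comp.
  by split; apply: filterS => i /pointwise.
Qed.

End CombinationUltrapower.

(** * Compactness of E-closed families *)

(** Finite parts of Phi are closed under union, so the sets of theories that
    contain one of them form a filter base, and local consistency says that no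
    member of the base is empty. *)
Lemma ultrafilter_of_locally_consistent (L : language) (F : set (theory L))
    (Phi : set (sentence L)) :
  locally_consistent F Phi ->
  exists2 U : set_system {S | F S}, UltraFilter U &
    forall f, Phi f -> U [set S | sval S f].
Proof.
move=> Phi_lc.
pose B (Phi0 : set (sentence L)) := [set S : {S | F S} | Phi0 `<=` sval S].
pose D := [set Phi0 | finite_set Phi0 /\ Phi0 `<=` Phi].
have B_filter : Filter (filter_from D B).
  apply: filter_from_filter; first by exists set0; split.
  move=> Phi1 Phi2 [fin1 sub1] [fin2 sub2]; exists (Phi1 `|` Phi2).
    by split; [rewrite finite_setU | rewrite subUset].
  by move=> S; rewrite /B/= subUset.
have B_proper : ProperFilter (filter_from D B).
  apply: filter_from_proper => Phi0 [fin0 sub0].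
  by have [S [FS Phi0S]] := Phi_lc _ fin0 sub0; exists (exist _ S FS).
have [U [U_ultra BU]] := ultraFilterLemma B_proper.
exists U => // f Phif; apply: BU; exists [set f]; first by split=> // g ->.
by move=> S; apply.
Qed.

Theorem theorem3p1 (L : language) (F : set (theory L))
    (F_neq0 : F !=set0)
    (F_complete : forall T, F T -> complete_theory T)
    (F_closed : E_closed F)
    (Phi : set (sentence L))
    (Phi_locally_consistent : locally_consistent F Phi) :
  consistent F Phi.
Proof.
have [U U_ultra U_Phi] :=
  ultrafilter_of_locally_consistent Phi_locally_consistent.
have F_inh : inhabited {S | F S} by have [S FS] := F_neq0; split; exists S.
have model (S : {S | F S}) : exists M : structure L, models M (sval S).
  by have [] := F_complete _ (svalP S).
pose A S := sval (cid (model S)).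
have A_models S : models (A S) (sval S) := svalP (cid (model S)).
have [x] := inhabited_forall (fun S => carrier_inhabited (A S)).
have [N [p UN]] := ultraproduct_exists (fun=> E_combination F_inh A)
  (_ : Filter U).
have UK := diagonal_class_ultraproduct U_ultra UN x.
set K := E_class _ in UK.
exists (theory_of K); split; last first.
  move=> f /U_Phi Uf; apply/(Los_sentence U_ultra UK).
  by apply: filterS Uf => S; apply: A_models.
suff : ClE F (theory_of K) by rewrite -F_closed.
exists F_inh, A, N; do 2![eexists]; split; last by [].
- exact: A_models.
- exact (ultrapower_elem_equiv U_ultra UN).
Qed.
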